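(* Let $(S_n)_{n\ge1}$ be a demimartingale and let $\tau$ be a stopping time such that, for every $j\ge1$, $I\{\tau\le j\}$ is a componentwise nondecreasing function of $S_1,\ldots,S_j$. Suppose that at least one of the following conditions holds: ($A_1$) $\tau$ is bounded (there is a constant $c$ with $\tau\le c$ a.s.); ($A_2$) $(S_n)_{n\ge1}$ is bounded (there is a constant $M<\infty$ with $|S_n|\le M$ for all $n$) and $\tau$ is finite a.s.; ($A_3$) $E(\tau)<\infty$ and there is $M>0$ such that $|S_k-S_{k-1}|\le M$ for all $k\ge2$. Then $E(S_\tau)\le E(S_1)$.
   Context: All random variables live on one probability space, and functions are understood to be Borel measurable. $I\{A\}$ denotes the indicator of the event $A$. A sequence of $L^1$ random variables $(S_n)_{n\ge1}$ is a demimartingale if for all $j\ge1$, $E[(S_{j+1}-S_j)f(S_1,\ldots,S_j)]\ge 0$ for all componentwise nondecreasing functions $f:\mathbb{R}^j\to\mathbb{R}$ for which the expectation is defined. A stopping time is a random variable $\tau$ with values in $\{1,2,\ldots\}\cup\{\infty\}$ with $\{\tau\le j\}\in\sigma(S_1,\ldots,S_j)$ for every $j\ge1$. ''$I\{\tau\le j\}$ is a componentwise nondecreasing function of $S_1,\ldots,S_j$'' means $I\{\tau\le j\}=h_j(S_1,\ldots,S_j)$ for some componentwise nondecreasing function $h_j$ on $\mathbb{R}^j$. *)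

(* Defs.v *)
From mathcomp Require Import all_boot all_order all_algebra.
From mathcomp Require Import all_classical all_reals all_analysis.

Set Implicit Arguments.
Unset Strict Implicit.
Unset Printing Implicit Defensive.

Import Order.TTheory GRing.Theory Num.Theory.
Import numFieldNormedType.Exports.

Local Open Scope classical_set_scope.
Local Open Scope ring_scope.

(* Sequences (S_n)_{n >= 1} are functions on nat whose value at 0 is never
   used.  Points of R^j are j-tuples, with the product Borel sigma-algebra. *)

Definition first_values (T : Type) (R : realType) (S : nat -> T -> R) (j : nat)
    (w : T) : j.-tuple R :=
  [tuple S i.+1 w | i < j].

Definition componentwise_nondecreasing (R : realType) (j : nat)
    (f : j.-tuple R -> R) : Prop :=
  forall x y : j.-tuple R,
    (forall i : 'I_j, tnth x i <= tnth y i) -> f x <= f y.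

(* E[X] is defined in [-oo, +oo]: X is measurable and E[X^+] - E[X^-] is not of
   the form +oo - oo. *)
Definition expectation_defined d (T : measurableType d) (R : realType)
    (P : probability T R) (X : T -> R) : Prop :=
  measurable_fun [set: T] X /\ (('E_P[X^\+] < +oo)%E \/ ('E_P[X^\-] < +oo)%E).

Definition demimartingale d (T : measurableType d) (R : realType)
    (P : probability T R) (S : nat -> T -> R) : Prop :=
  (forall n, (1 <= n)%N -> S n \in Lfun P 1%E) /\
  (forall j, (1 <= j)%N -> forall f : j.-tuple R -> R,
     measurable_fun [set: j.-tuple R] f ->
     componentwise_nondecreasing f ->
     let X := fun w => (S j.+1 w - S j w) * f (first_values S j w) in
     expectation_defined P X -> (0 <= 'E_P[X])%E).

(* Random times with values in nat U {oo}; None stands for oo. *)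
Definition time_ereal (R : realType) (t : option nat) : \bar R :=
  if t is Some n then (n%:R)%:E else +oo%E.

Definition time_le (t : option nat) (j : nat) : bool :=
  if t is Some n then (n <= j)%N else false.

Definition stopping_time (T : Type) (R : realType) (S : nat -> T -> R)
    (tau : T -> option nat) : Prop :=
  (forall w n, tau w = Some n -> (1 <= n)%N) /\
  (forall j, (1 <= j)%N ->
     g_sigma_preimage (fun i : 'I_j => S i.+1) [set w | time_le (tau w) j]).

(* S_tau, set to 0 on the event tau = oo. *)
Definition stopped_value (T : Type) (R : realType) (S : nat -> T -> R)
    (tau : T -> option nat) (w : T) : R :=
  if tau w is Some n then S n w else 0.

(* Main.v *)
Require Import Defs.
From mathcomp Require Import all_boot all_order all_algebra.
From mathcomp Require Import all_classical all_reals all_analysis.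
From mathcomp Require Import measurable_realfun.

Set Implicit Arguments.
Unset Strict Implicit.
Unset Printing Implicit Defensive.

Import Order.TTheory GRing.Theory Num.Theory.
Import numFieldNormedType.Exports.

Local Open Scope classical_set_scope.
Local Open Scope ring_scope.

(** Write X_n = S_(min(tau, n)) for the stopped process. It satisfies
[[
  X_(n+1) = X_n + (S_(n+1) - S_n) - (S_(n+1) - S_n) * I{tau <= n}.
]]
Testing the demimartingale property against the constants 1 and -1, which are
both nondecreasing, gives E[S_(n+1) - S_n] = 0. Testing it against
I{tau <= n}, a nondecreasing function of S_1, ..., S_n, shows that the last
term is subtracted with a nonnegative expectation. So E[X_n] decreases from
E[X_1] = E[S_1] ([stopped_process_expectation_le]).

When tau is almost surely finite, X_n is eventually constant, equal to S_tau.
The bound on E[X_n] passes to the limit by dominated convergence as soon as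
one integrable function dominates every X_n
([dominated_optional_stopping]). The dominating functions are:
- |S_1| + ... + |S_N| when tau <= c < N;
- the constant M when |S_n| <= M for all n;
- |S_1| + M tau when E[tau] is finite and the increments are bounded by M.
*)

(** * Random times and the stopped process *)

(** The hypothesis that every I{tau <= j} is a Borel, componentwise
nondecreasing function of S_1, ..., S_j. *)
Definition nondecreasing_time (T : Type) (R : realType) (S : nat -> T -> R)
    (tau : T -> option nat) : Prop :=
  forall j, (1 <= j)%N -> exists h : j.-tuple R -> R,
     [/\ measurable_fun [set: j.-tuple R] h,
         componentwise_nondecreasing h &
         forall w, \1_[set w' | time_le (tau w') j] w = h (first_values S j w)].

(** The stopped process S_(min(tau, n)), which is S_n on the event tau = oo.
Only the indices n >= 1 are meaningful. *)
Definition stopped_process (T : Type) (R : realType) (S : nat -> T -> R)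
    (tau : T -> option nat) (n : nat) (w : T) : R :=
  if tau w is Some m then S (minn m n) w else S n w.

Lemma stopped_process1 (T : Type) (R : realType) (S : nat -> T -> R)
    (tau : T -> option nat) :
  (forall w n, tau w = Some n -> (1 <= n)%N) -> stopped_process S tau 1 = S 1%N.
Proof.
move=> tau1; apply/funext => w; rewrite /stopped_process.
by case E: (tau w) => [m|//]; rewrite (minn_idPr (tau1 _ _ E)).
Qed.

Lemma stopped_processS (T : Type) (R : realType) (S : nat -> T -> R)
    (tau : T -> option nat) (n : nat) :
  stopped_process S tau n.+1 =
    (stopped_process S tau n \+ (S n.+1 \- S n)) \-
    ((S n.+1 \- S n) \* \1_[set w | time_le (tau w) n]).
Proof.
apply/funext => w /=; rewrite /stopped_process indicE /=.
have [tn|tn] := boolP (time_le (tau w) n).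
  rewrite mem_set//= mulr1 addrK; case: (tau w) tn => [m|//] /= mn.
  by rewrite (minn_idPl mn) (minn_idPl (leqW mn)).
rewrite memNset/=; last exact/negP.
rewrite mulr0 subr0; case: (tau w) tn => [m|_] /=; last by rewrite addrC subrK.
rewrite -ltnNge => nm.
by rewrite (minn_idPr nm) (minn_idPr (ltnW nm)) addrC subrK.
Qed.

Lemma stopped_process_eventually (T : Type) (R : realType) (S : nat -> T -> R)
    (tau : T -> option nat) (w : T) (m : nat) :
  tau w = Some m -> \forall n \near \oo, stopped_process S tau n.+1 w = S m w.
Proof.
move=> E; exists m => // n /= mn.
by rewrite /stopped_process E (minn_idPl (leqW mn)).
Qed.

Lemma stopped_process_value (T : Type) (R : realType) (S : nat -> T -> R)
    (tau : T -> option nat) (n : nat) (w : T) :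
  (forall w n, tau w = Some n -> (1 <= n)%N) ->
  (time_ereal R (tau w) < +oo)%E ->
  exists m k, [/\ tau w = Some m, (1 <= k <= m)%N &
                  stopped_process S tau n.+1 w = S k w].
Proof.
move=> tau1; rewrite /stopped_process; case E: (tau w) => [m|//] _.
exists m, (minn m n.+1); split => //.
by rewrite leq_min (tau1 _ _ E) geq_minl.
Qed.

(** * Measurability *)

Lemma measurable_first_values d (T : measurableType d) (R : realType)
    (S : nat -> T -> R) (j : nat) :
  (forall n, (1 <= n)%N -> measurable_fun [set: T] (S n)) ->
  measurable_fun [set: T] (first_values S j).
Proof.
move=> mS; apply/measurable_fun_tnthP => i.
rewrite (_ : _ \o _ = S i.+1); first exact: mS.
by apply/funext => w /=; rewrite tnth_mktuple.
Qed.

Lemma nondecreasing_time_measurable d (T : measurableType d) (R : realType)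
    (S : nat -> T -> R) (tau : T -> option nat) :
  (forall n, (1 <= n)%N -> measurable_fun [set: T] (S n)) ->
  nondecreasing_time S tau ->
  forall j, (1 <= j)%N -> measurable [set w | time_le (tau w) j].
Proof.
move=> mS nd j j1; have [h [mh _ hE]] := nd j j1.
apply/(measurable_indicP R); rewrite (_ : \1_ _ = h \o first_values S j).
  by apply: measurableT_comp => //; exact: measurable_first_values.
by apply/funext => w; rewrite hE.
Qed.

Lemma measurable_stopped_process d (T : measurableType d) (R : realType)
    (S : nat -> T -> R) (tau : T -> option nat) :
  (forall n, (1 <= n)%N -> measurable_fun [set: T] (S n)) ->
  (forall w n, tau w = Some n -> (1 <= n)%N) ->
  (forall j, (1 <= j)%N -> measurable [set w | time_le (tau w) j]) ->
  forall n, measurable_fun [set: T] (stopped_process S tau n.+1).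
Proof.
move=> mS tau1 mtau; elim=> [|n IH]; first by rewrite stopped_process1//; exact: mS.
rewrite stopped_processS.
have mD : measurable_fun [set: T] (S n.+2 \- S n.+1).
  by apply: measurable_funB; exact: mS.
apply: measurable_funB; first exact: measurable_funD.
by apply: measurable_funM => //; apply/measurable_indicP; exact: mtau.
Qed.

(** Setting X_n to 0 on {tau > n} gives pointwise convergence to S_tau also on
the event tau = oo, where S_tau is 0. *)
Lemma measurable_stopped_value d (T : measurableType d) (R : realType)
    (S : nat -> T -> R) (tau : T -> option nat) :
  (forall n, (1 <= n)%N -> measurable_fun [set: T] (S n)) ->
  (forall w n, tau w = Some n -> (1 <= n)%N) ->
  (forall j, (1 <= j)%N -> measurable [set w | time_le (tau w) j]) ->
  measurable_fun [set: T] (stopped_value S tau).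
Proof.
move=> mS tau1 mtau.
apply: (@measurable_fun_cvg _ _ _ _
  (fun n => stopped_process S tau n.+1 \* \1_[set w | time_le (tau w) n.+1])).
  move=> n; apply: measurable_funM; first exact: measurable_stopped_process.
  by apply/measurable_indicP; exact: mtau.
move=> w _; apply: cvg_near_cst; rewrite /stopped_value.
case E: (tau w) => [m|].
  near=> n; rewrite /=.
  have -> : stopped_process S tau n.+1 w = S m w.
    by near: n; exact: stopped_process_eventually.
  rewrite indicE mem_set/= ?mulr1// E /=; apply: leqW.
  by near: n; exact: nbhs_infty_ge.
by near=> n; rewrite /= indicE memNset/= ?mulr0// E.
Unshelve. all: by end_near. Qed.

Lemma measurable_time_ereal d (T : measurableType d) (R : realType)
    (tau : T -> option nat) :
  (forall w n, tau w = Some n -> (1 <= n)%N) ->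
  (forall j, (1 <= j)%N -> measurable [set w | time_le (tau w) j]) ->
  measurable_fun [set: T] (fun w => time_ereal R (tau w)).
Proof.
move=> tau1 mtau.
(* The deterministic process S_n = n stopped at tau is min(tau, n). *)
pose S (n : nat) (w : T) : R := n%:R.
apply: (@emeasurable_fun_cvg _ _ _ _
  (fun n w => (stopped_process S tau n.+1 w)%:E)).
  move=> n; apply/measurable_EFinP; apply: measurable_stopped_process => //.
  by move=> k _; exact: measurable_cst.
move=> w _; case E: (tau w) => [m|] /=.
  apply: cvg_near_cst; near=> n.
  by congr EFin; near: n; exact: stopped_process_eventually.
rewrite /stopped_process E /S.
apply/cvgeryP; rewrite (cvg_shiftS (fun n => n%:R : R)); exact: cvgr_idn.
Unshelve. all: by end_near. Qed.

(** * Integrability and expectation of the stopped process *)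

Lemma Lfun1_measurable_fun d (T : measurableType d) (R : realType)
    (P : probability T R) (X : T -> R) :
  X \in Lfun P 1%E -> measurable_fun [set: T] X.
Proof.
move=> /Lfun1_integrable iX.
by apply/measurable_EFinP; exact: measurable_int iX.
Qed.

Lemma Lfun1_mul_indic d (T : measurableType d) (R : realType)
    (P : probability T R) (X : T -> R) (A : set T) :
  measurable A -> X \in Lfun P 1%E -> X \* \1_A \in Lfun P 1%E.
Proof.
move=> mA LX; have /Lfun1_integrable iX := LX; apply/Lfun1_integrable.
apply: (le_integrable _ _ _ iX) => //.
  apply/measurable_EFinP; apply: measurable_funM; last exact/measurable_indicP.
  exact: Lfun1_measurable_fun LX.
move=> w _ /=; rewrite lee_fin normrM indicE ler_piMr//.
by case: (w \in A); rewrite ?normr1 ?normr0.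
Qed.

Lemma Lfun1_expectation_defined d (T : measurableType d) (R : realType)
    (P : probability T R) (X : T -> R) :
  X \in Lfun P 1%E -> expectation_defined P X.
Proof.
move=> LX; split; first exact: Lfun1_measurable_fun LX.
have /Lfun1_integrable iX := LX.
left; rewrite unlock.
have /integrableP[_] := integrable_funrpos measurableT iX.
apply: le_lt_trans; apply: le_trans (le_abse_integral _ _ _) => //.
  exact: lee_abs.
by apply: measurable_int (integrable_funrpos measurableT iX).
Qed.

(** The constants 1 and -1 are both nondecreasing test functions. *)
Lemma demimartingale_expectation_increment d (T : measurableType d) (R : realType)
    (P : probability T R) (S : nat -> T -> R) (j : nat) :
  demimartingale P S -> (1 <= j)%N -> ('E_P[S j.+1 \- S j] = 0)%E.
Proof.
move=> [LS dS] j1.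
have LD : S j.+1 \- S j \in Lfun P 1%E by rewrite rpredB//; exact: LS.
have cD_ge0 (c : R) : (0 <= c%:E * 'E_P[S j.+1 \- S j])%E.
  rewrite -expectationZl//.
  have := dS j j1 (cst c) (measurable_cst _) (fun _ _ _ => lexx _).
  apply; apply: Lfun1_expectation_defined.
  exact: Lfun_scale (lexx _) LD.
apply/eqP; rewrite eq_le; apply/andP; split.
  by have := cD_ge0 (-1); rewrite EFinN mulN1e oppe_ge0.
by have := cD_ge0 1; rewrite mul1e.
Qed.

Lemma stopped_process_Lfun1 d (T : measurableType d) (R : realType)
    (P : probability T R) (S : nat -> T -> R) (tau : T -> option nat) (n : nat) :
  (forall n, (1 <= n)%N -> S n \in Lfun P 1%E) ->
  (forall w n, tau w = Some n -> (1 <= n)%N) ->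
  (forall j, (1 <= j)%N -> measurable [set w | time_le (tau w) j]) ->
  stopped_process S tau n.+1 \in Lfun P 1%E.
Proof.
move=> LS tau1 mtau; elim: n => [|n IH]; first by rewrite stopped_process1//; exact: LS.
have LD : S n.+2 \- S n.+1 \in Lfun P 1%E by rewrite rpredB//; exact: LS.
rewrite stopped_processS; apply: rpredB; first exact: rpredD.
by apply: (Lfun1_mul_indic _ LD); exact: mtau.
Qed.

Lemma stopped_process_expectation_le d (T : measurableType d) (R : realType)
    (P : probability T R) (S : nat -> T -> R) (tau : T -> option nat) (n : nat) :
  demimartingale P S -> nondecreasing_time S tau ->
  (forall w n, tau w = Some n -> (1 <= n)%N) ->
  (forall j, (1 <= j)%N -> measurable [set w | time_le (tau w) j]) ->
  ('E_P[stopped_process S tau n.+1] <= 'E_P[S 1%N])%E.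
Proof.
move=> dS nd tau1 mtau; have [LS incr] := dS.
elim: n => [|n IH]; first by rewrite stopped_process1.
have LD : S n.+2 \- S n.+1 \in Lfun P 1%E by rewrite rpredB//; exact: LS.
have LI := Lfun1_mul_indic (mtau n.+1 isT) LD.
have LX := @stopped_process_Lfun1 _ _ _ _ _ _ n LS tau1 mtau.
have LXD : stopped_process S tau n.+1 \+ (S n.+2 \- S n.+1) \in Lfun P 1%E.
  exact: rpredD.
rewrite stopped_processS expectationB// expectationD//.
rewrite demimartingale_expectation_increment// adde0.
apply: le_trans IH; rewrite leeBlDr ?expectation_fin_num//.
(* It remains that the term removed from X_(n+1) has nonnegative expectation. *)
rewrite leeDl//.
have [h [mh ndh hE]] := nd n.+1 isT.
have XE : (S n.+2 \- S n.+1) \* \1_[set w | time_le (tau w) n.+1] =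
    fun w => (S n.+2 w - S n.+1 w) * h (first_values S n.+1 w).
  by apply/funext => w /=; rewrite hE.
rewrite XE; apply: incr => //.
by rewrite -XE; exact: Lfun1_expectation_defined.
Qed.

(** * Passage to the limit *)

Lemma dominated_optional_stopping d (T : measurableType d) (R : realType)
    (P : probability T R) (S : nat -> T -> R) (tau : T -> option nat)
    (g : T -> \bar R) :
  demimartingale P S -> nondecreasing_time S tau ->
  (forall w n, tau w = Some n -> (1 <= n)%N) ->
  {ae P, forall w, (time_ereal R (tau w) < +oo)%E} ->
  P.-integrable [set: T] g ->
  {ae P, forall w, forall n, (`|(stopped_process S tau n.+1 w)%:E| <= g w)%E} ->
  stopped_value S tau \in Lfun P 1%E /\
  ('E_P[stopped_value S tau] <= 'E_P[S 1%N])%E.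
Proof.
move=> dS nd tau1 tauoo ig bg; have [LS _] := dS.
have mS n : (1 <= n)%N -> measurable_fun [set: T] (S n).
  by move=> /LS; exact: Lfun1_measurable_fun.
have mtau := nondecreasing_time_measurable mS nd.
have [|||||iX _ cvgE] := @dominated_convergence _ _ _ P setT measurableT
  (fun n w => (stopped_process S tau n.+1 w)%:E)
  (EFin \o stopped_value S tau) g.
- by move=> n; apply/measurable_EFinP; exact: measurable_stopped_process.
- by apply/measurable_EFinP; exact: measurable_stopped_value.
- apply: filterS tauoo => w + _; case E: (tau w) => [m|]// _.
  apply: cvg_near_cst; rewrite /= /stopped_value E; near=> n.
  by congr EFin; near: n; exact: stopped_process_eventually.
- exact: ig.
- by apply: filterS bg => w bw n _; exact: bw.
split; first exact/Lfun1_integrable.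
rewrite [in X in (X <= _)%E]unlock -(cvg_lim _ cvgE)//.
apply: lime_le; first by apply/cvg_ex; eexists; exact: cvgE.
near=> n; have := @stopped_process_expectation_le _ _ _ _ _ _ n dS nd tau1 mtau.
by rewrite [in X in (X <= _)%E -> _]unlock.
Unshelve. all: by end_near. Qed.

(** The sharp bound has m - 1 in place of m; the weaker form suffices. *)
Lemma norm_le_bounded_increments (R : realType) (u : nat -> R) (M : R) (m : nat) :
  0 <= M -> (forall k, (2 <= k)%N -> `|u k - u k.-1| <= M) ->
  (1 <= m)%N -> `|u m| <= `|u 1%N| + M * m%:R.
Proof.
move=> M0 du; case: m => // m _; elim: m => [|m IH].
  by rewrite lerDl mulr1.
rewrite -(subrK (u m.+1) (u m.+2)) (le_trans (ler_normD _ _))//.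
rewrite -natr1 mulrDr mulr1 addrA addrC lerD//.
exact: (du m.+2).
Qed.

Theorem theorem3p1 (d : measure_display) (T : measurableType d) (R : realType)
  (P : probability T R) (S : nat -> T -> R) (tau : T -> option nat)
  (hS : demimartingale P S)
  (htau : stopping_time S tau)
  (hmono : forall j, (1 <= j)%N -> exists h : j.-tuple R -> R,
     [/\ measurable_fun [set: j.-tuple R] h,
         componentwise_nondecreasing h &
         forall w, \1_[set w' | time_le (tau w') j] w = h (first_values S j w)])
  (hA :
     (* A1 *)
     (exists c : R, {ae P, forall w, (time_ereal R (tau w) <= c%:E)%E}) \/
     (* A2 *)
     ((exists M : R, forall n, (1 <= n)%N -> {ae P, forall w, `|S n w| <= M}) /\
      {ae P, forall w, (time_ereal R (tau w) < +oo)%E}) \/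
     (* A3 *)
     ((\int[P]_w time_ereal R (tau w) < +oo)%E /\
      (exists2 M : R, 0 < M &
         forall k, (2 <= k)%N -> {ae P, forall w, `|S k w - S k.-1 w| <= M}))) :
  stopped_value S tau \in Lfun P 1%E /\
  ('E_P[stopped_value S tau] <= 'E_P[S 1%N])%E.
Proof.
have [tau1 _] := htau; have [LS _] := hS.
have mS n : (1 <= n)%N -> measurable_fun [set: T] (S n).
  by move=> /LS; exact: Lfun1_measurable_fun.
have iabsS n : (1 <= n)%N -> P.-integrable [set: T] (fun w => `|S n w|%:E).
  by move=> /LS /Lfun_norm /Lfun1_integrable.
case: hA => [[c tauc]|[[[M bM] tauoo]|[Etau [M M0 dM]]]].
- have [N cN] : exists N : nat, c < N%:R.
    by exists (Num.bound `|c|); rewrite (le_lt_trans (ler_norm c))// archi_boundP.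
  apply: (@dominated_optional_stopping _ _ _ _ _ _
    (fun w => \sum_(0 <= k < N) `|S k.+1 w|%:E)%E) => //.
  + by apply: filterS tauc => w tw; rewrite (le_lt_trans tw)// ltry.
  + by apply: integrable_sum => // k _; exact: iabsS.
  + apply: filterS tauc => w tw n.
    have [|m [k [E /andP[k1 km] ->]]] := @stopped_process_value _ _ S _ n w tau1.
      by rewrite (le_lt_trans tw)// ltry.
    have mN : (m < N)%N.
      by rewrite -(ltr_nat R) (le_lt_trans _ cN)//; move: tw; rewrite E lee_fin.
    rewrite sumEFin lee_fin big_mkord.
    have kN : (k.-1 < N)%N by rewrite prednK// (leq_trans km)// ltnW.
    rewrite (bigD1 (Ordinal kN))//= prednK// lerDl; exact: sumr_ge0.
- apply: (@dominated_optional_stopping _ _ _ _ _ _ (cst M%:E)) => //.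
    exact: (proj1 (Lfun1_integrable P (cst M)) (Lfun_cst P M 1)).
  have bM' : {ae P, forall w, forall n, `|S n.+1 w| <= M}.
    by apply: ae_foralln => n; exact: bM.
  apply: filterS2 tauoo bM' => w tw bw n.
  have [//|m [k [E /andP[k1 km] ->]]] := @stopped_process_value _ _ S _ n w tau1.
  by rewrite lee_fin -(prednK k1).
- have mtau := @measurable_time_ereal _ _ R _ tau1
    (nondecreasing_time_measurable mS hmono).
  have t0 w : (0 <= time_ereal R (tau w))%E.
    by case: (tau w) => [m|]//=; rewrite lee_fin.
  have itau : P.-integrable [set: T] (fun w => time_ereal R (tau w)).
    apply/integrableP; split => //.
    by under eq_integral do rewrite gee0_abs//.
  have tauoo : {ae P, forall w, (time_ereal R (tau w) < +oo)%E}.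
    apply: filterS (integrable_ae measurableT itau) => w /(_ I).
    by rewrite ge0_fin_numE.
  apply: (@dominated_optional_stopping _ _ _ _ _ _
    (fun w => `|S 1%N w|%:E + M%:E * time_ereal R (tau w))%E) => //.
    apply: integrableD => //; first exact: iabsS.
    exact: integrableZl.
  have dM' : {ae P, forall w, forall n, `|S n.+2 w - S n.+1 w| <= M}.
    by apply: ae_foralln => n; exact: (dM n.+2).
  apply: filterS2 tauoo dM' => w tw dw n.
  have [//|m [k [E /andP[k1 km] ->]]] := @stopped_process_value _ _ S _ n w tau1.
  rewrite E /= lee_fin.
  have dw' j : (2 <= j)%N -> `|S j w - S j.-1 w| <= M.
    by case: j => [|[|j]]// _; exact: dw.
  apply: (le_trans (@norm_le_bounded_increments _ (S^~ w) _ _ (ltW M0) dw' k1)).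
  by rewrite lerD2l ler_wpM2l ?ler_nat// ltW.
Qed.
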